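(* Let $\Theta$ be a parameter space, $\mathcal{A}$ an action space, $L:\Theta\times\mathcal{A}\to[0,\infty)$ a nonnegative loss function, $\mathcal{P}=\{P_\theta:\theta\in\Theta\}$ a family of probability measures on a sample space $\mathcal{X}$, and $w$ a prior probability measure on $\Theta$. For $a\in\mathcal{A}$, $t>0$ let $B_t(a,L):=\{\theta\in\Theta:L(\theta,a)<t\}$. The Bayes risk $R_{\rm Bayes}(w,L;\Theta)$ satisfies each of the following inequalities, where in each item $I_f^{\rm up}$ denotes any upper bound on the corresponding $f$-informativity $I_f(w,\mathcal{P})$: (i) KL divergence ($f(x)=x\log x$): $$R_{\rm Bayes}(w,L;\Theta)\ge\frac12\sup\Big\{t>0:\sup_{a\in\mathcal{A}}w(B_t(a,L))<\frac14e^{-2I_f^{\rm up}}\Big\}.$$ (ii) Chi-squared divergence ($f(x)=x^2-1$): $$R_{\rm Bayes}(w,L;\Theta)\ge\frac12\sup\Big\{t>0:\sup_{a\in\mathcal{A}}w(B_t(a,L))<\frac{1}{4(1+I_f^{\rm up})}\Big\}.$$ (iii) Total variation distance ($f(x)=|x-1|/2$): $$R_{\rm Bayes}(w,L;\Theta)\ge\frac12\sup\Big\{t>0:\sup_{a\in\mathcal{A}}w(B_t(a,L))<\frac12-I_f^{\rm up}\Big\}.$$ (iv) Hellinger distance ($f(x)=1-\sqrt x$): if $I_f^{\rm up}<1-1/\sqrt2$, then $$R_{\rm Bayes}(w,L;\Theta)\ge\frac12\sup\Big\{t>0:\sup_{a\in\mathcal{A}}w(B_t(a,L))<\frac12-(1-I_f^{\rm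 up})\sqrt{I_f^{\rm up}(2-I_f^{\rm up})}\Big\}.$$
   Context: All functions and sets are assumed measurable as needed. The supremum of the empty set is taken to be $0$. The Bayes risk is $R_{\rm Bayes}(w,L;\Theta):=\inf_{\mathfrak{d}}\int_\Theta \mathbb{E}_\theta L(\theta,\mathfrak{d}(X))\,w(\mathrm{d}\theta)$, the infimum being over all decision rules $\mathfrak{d}:\mathcal{X}\to\mathcal{A}$, where $\mathbb{E}_\theta$ is expectation under $X\sim P_\theta$. For convex $f:(0,\infty)\to\mathbb{R}$ with $f(1)=0$, put $f(0):=\lim_{x\downarrow0}f(x)$ and $f'(\infty):=\lim_{x\uparrow\infty}f(x)/x$ (possibly $+\infty$). For probability measures $P,Q$ with densities $p,q$ with respect to a common measure $\mu$, $D_f(P\|Q):=\int f(p/q)\,q\,\mathrm{d}\mu+f'(\infty)P\{q=0\}$, with the convention $0\cdot\infty=0$. The $f$-informativity is $I_f(w,\mathcal{P}):=\inf_Q\int_\Theta D_f(P_\theta\|Q)\,w(\mathrm{d}\theta)$, the infimum being over all probability measures $Q$ on $\mathcal{X}$. For the four choices of $f$ above, $D_f(P\|Q)$ is respectively the Kullback–Leibler divergence, the chi-squared divergence $\int p^2/q\,\mathrm{d}\mu-1$ (infinite unless $P\ll Q$), the total variation distance $\tfrac12\int|p-q|\,\mathrm{d}\mu$, and $1-\int\sqrt{pq}\,\mathrm{d}\mu=\tfrac12\int(\sqrt p-\sqrt q)^2\,\mathrm{d}\mu$ (half the squared Hellinger distance). *)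

(* Defs.v *)
From HB Require Import structures.
From mathcomp Require Import all_boot all_order all_algebra.
From mathcomp Require Import all_classical all_reals all_analysis.
From mathcomp Require Import measurable_realfun.

Set Implicit Arguments.
Unset Strict Implicit.
Unset Printing Implicit Defensive.

Import Order.TTheory GRing.Theory Num.Theory.
Import numFieldNormedType.Exports.

Local Open Scope classical_set_scope.
Local Open Scope ring_scope.
Local Open Scope ereal_scope.

(* Supremum with the convention sup(empty) = 0 (ereal_sup set0 is -oo). *)
Definition sup0 (R : realType) (S : set (\bar R)) : \bar R :=
  if S == set0 then 0 else ereal_sup S.

(* f(0) := lim_{x -> 0+} f(x); the value of the function f at 0 is ignored. *)
Definition f_at0 (R : realType) (f : R -> R) : \bar R :=
  lim ((f x)%:E @[x --> (0 : R)^'+]).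

(* f'(oo) := lim_{x -> +oo} f(x) / x *)
Definition f_slope (R : realType) (f : R -> R) : \bar R :=
  lim ((f x / x)%:E @[x --> +oo%R]).

Definition f_ext (R : realType) (f : R -> R) (x : R) : \bar R :=
  if x == 0%R then f_at0 f else (f x)%:E.

(* p and q are densities of P and Q with respect to mu. Where q x = 0, the
   quotient p x / q x is 0 and the integrand is f_at0 f * 0 = 0, which is
   the convention 0 * oo = 0; the second product uses it as well. *)
Definition fdiv_density d (X : measurableType d) (R : realType) (f : R -> R)
    (mu : {measure set X -> \bar R}) (P : probability X R) (p q : X -> R) :
    \bar R :=
  \int[mu]_x (f_ext f (p x / q x) * (q x)%:E)
  + f_slope f * P [set x | q x = 0%R].

Definition sum_measure d (X : measurableType d) (R : realType)
    (P Q : probability X R) : set X -> \bar R := measure_add P Q.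

HB.instance Definition _ d (X : measurableType d) (R : realType)
  (P Q : probability X R) := Measure.on (sum_measure P Q).

Lemma sum_measure_fin d (X : measurableType d) (R : realType)
  (P Q : probability X R) : fin_num_fun (sum_measure P Q).
Proof.
by move=> U mU; rewrite /sum_measure measure_addE fin_numD !fin_num_measure.
Qed.

HB.instance Definition _ d (X : measurableType d) (R : realType)
  (P Q : probability X R) :=
  Measure_isFinite.Build d X R (sum_measure P Q) (@sum_measure_fin d X R P Q).

(* Radon_Nikodym returns a junk constant unless domination holds. *)
Lemma sum_measure_dominates d (X : measurableType d) (R : realType)
  (P Q : probability X R) :
  P `<< sum_measure P Q /\ Q `<< sum_measure P Q.
Proof.
split; apply/null_content_dominatesP => U mU;
  rewrite [X in X = 0 -> _](measure_addE P Q) => /eqP;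
  by rewrite padde_eq0// => /andP[/eqP ? /eqP ?].
Qed.

(* A real-valued density of N with respect to P + Q, used for N = P and N = Q. *)
Definition density d (X : measurableType d) (R : realType)
    (P Q N : probability X R) (x : X) : R :=
  fine (Radon_Nikodym (charge_of_finite_measure N) (sum_measure P Q) x).

(* D_f(P || Q) does not depend on the common dominating measure or on the
   versions of the densities; P + Q always dominates both P and Q. *)
Definition fdiv d (X : measurableType d) (R : realType) (f : R -> R)
    (P Q : probability X R) : \bar R :=
  fdiv_density f (sum_measure P Q) P (density P Q P) (density P Q Q).

Definition f_informativity d d' (Theta : measurableType d)
    (X : measurableType d') (R : realType) (f : R -> R)
    (w : probability Theta R) (P : Theta -> probability X R) : \bar R :=
  ereal_inf (range (fun Q : probability X R => \int[w]_th fdiv f (P th) Q)).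

Definition f_KL (R : realType) (x : R) : R := (x * ln x)%R.
Definition f_chi2 (R : realType) (x : R) : R := (x ^+ 2 - 1)%R.
Definition f_TV (R : realType) (x : R) : R := (`|x - 1| / 2)%R.
Definition f_Hellinger (R : realType) (x : R) : R := (1 - Num.sqrt x)%R.

Definition Bayes_risk d d' d'' (Theta : measurableType d)
    (X : measurableType d') (A : measurableType d'') (R : realType)
    (w : probability Theta R) (P : Theta -> probability X R)
    (L : Theta -> A -> R) : \bar R :=
  ereal_inf (range (fun dec : {mfun X >-> A} =>
    \int[w]_th 'E_(P th)[fun x => L th (dec x)])).

Definition loss_ball (Theta A : Type) (R : realType) (L : Theta -> A -> R)
    (t : R) (a : A) : set Theta :=
  [set th | (L th a < t)%R].

(* sup {t > 0 : sup_a w(B_t(a, L)) < c} *)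
Definition sup_radius d (Theta : measurableType d) (A : Type) (R : realType)
    (w : probability Theta R) (L : Theta -> A -> R) (c : \bar R) : \bar R :=
  sup0 [set t%:E | t in
    [set t : R | (0 < t)%R /\ sup0 (range (fun a => w (loss_ball L t a))) < c]].

(* Main.v *)
Require Import Defs.
From HB Require Import structures.
From mathcomp Require Import all_boot all_order all_algebra.
From mathcomp Require Import all_classical all_reals all_analysis.
From mathcomp Require Import measurable_realfun.
From mathcomp Require Import ring lra.

Set Implicit Arguments.
Unset Strict Implicit.
Unset Printing Implicit Defensive.

Import Order.TTheory GRing.Theory Num.Theory.
Import numFieldNormedType.Exports.

Local Open Scope classical_set_scope.
Local Open Scope ring_scope.
Local Open Scope ereal_scope.

(** Fix a decision rule [dec] and a radius [t], and let [E th] be the event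
    that the loss of [dec] at [th] is below [t]. By Markov's inequality the
    risk of [dec] is at least [t * (1 - p)], where [p] is the average over the
    prior of [P th (E th)]; so it suffices to show [p <= 1/2]. For any
    probability [Q], Tonelli's theorem turns the average [q] of [Q (E th)] into
    the [Q]-integral of the prior masses of the balls around [dec x], hence
    [q <= s] for every [s] above the small-ball probability. If [p] exceeded
    [1/2], the test [E th] would distinguish [P th] from [Q] on average, and
    this forces the average divergence from [Q] to be large.

    The last step is done by duality rather than by the data-processing
    inequality followed by Jensen's. If two lines [alpha * u + a] and
    [beta * u + b] lie below [f], then
      [D_f(P || Q) >= alpha P(E) + beta P(~E) + a Q(E) + b Q(~E)]
    ([fdiv_ge]): use the first line on [E] and the second one off [E]. This
    bound is affine in [P(E)] and [Q(E)], so averaging it over the prior is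
    mere linearity ([average_fdiv_ge]), and the coefficients may depend on [s]
    but not on [Q], so that the bound passes to the infimum over [Q]
    ([f_informativity_ge]). It remains to exhibit, for each [f], two supporting
    lines whose bound at [p = 1/2], [q = s] exceeds the informativity as soon
    as [s] is below the threshold ([Bayes_risk_ge]). The optimal tangency
    points are the two likelihood ratios [(1/2) / s] and [(1/2) / (1 - s)].

    Duality also settles a measurability issue: [th |-> D_f(P th || Q)] need
    not be measurable, since the densities depend on [th] without any joint
    measurability, but its integral (a lower integral for nonnegative
    functions) still dominates the integral of any measurable minorant
    ([le_integral_nonmeasurable]), and [th |-> P th (E th)] is measurable. *)

(** * Integrals of possibly non-measurable functions *)

(** The integral of a nonnegative function is a supremum over the simple
    functions below it, which is monotone without any measurability. *)
Lemma ge0_le_integral_nonmeasurable d (T : measurableType d) (R : realType)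
    (mu : {measure set T -> \bar R}) (g h : T -> \bar R) :
  (forall x, 0 <= g x) -> (forall x, g x <= h x) ->
  \int[mu]_x g x <= \int[mu]_x h x.
Proof.
move=> g0 gh; rewrite !ge0_integralTE//; last first.
  by move=> x; exact: le_trans (gh x).
apply: ereal_sup_le => _ [k kg <-]; exists k => //= x.
exact: le_trans (gh x).
Qed.

(** Changing [g] to [-oo] on the exceptional null set turns the almost
    everywhere inequality into a pointwise one, to which monotonicity applies
    separately for the positive and the negative parts. *)
Lemma le_integral_nonmeasurable d (T : measurableType d) (R : realType)
    (mu : {measure set T -> \bar R}) (g h : T -> \bar R) :
  measurable_fun [set: T] g -> {ae mu, forall x, g x <= h x} ->
  \int[mu]_x g x <= \int[mu]_x h x.
Proof.
move=> mg [N [mN N0 ghN]].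
pose k x := if x \in N then -oo else g x.
have mk : measurable_fun [set: T] k.
  apply: measurable_fun_ifT => //.
  by apply: (measurable_fun_bool true) => //; rewrite setTI preimage_mem_true.
have -> : \int[mu]_x g x = \int[mu]_x k x.
  apply: ae_eq_integral => //.
  exists N; split => // x /=.
  apply: contra_notP => xN _; rewrite /k ifF//.
  exact: memNset.
have kh x : k x <= h x.
  rewrite /k; case: ifPn => [_|]; first exact: leNye.
  by rewrite notin_setE => xN; apply: contra_notP xN => /ghN.
rewrite integralE [leRHS]integralE leeB//.
- apply: ge0_le_integral_nonmeasurable => // x.
  by apply: (@funepos_le _ _ setT) => [y _|]; rewrite ?kh ?inE.
- apply: ge0_le_integral_nonmeasurable => // x.
  by apply: (@funeneg_le _ _ setT) => [y _|]; rewrite ?kh ?inE.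
Qed.

(** * The densities with respect to the sum of two probabilities *)

Section densities.
Context d (X : measurableType d) (R : realType) (P Q N : probability X R).
Hypothesis Nmu : N `<< sum_measure P Q.
Let mu := sum_measure P Q.
Let n := density P Q N.

Let densityE x :
  (n x)%:E = Radon_Nikodym (charge_of_finite_measure N) mu x.
Proof. by rewrite /n /density fineK// Radon_Nikodym_fin_num. Qed.

Lemma integrable_density : mu.-integrable [set: X] (EFin \o n).
Proof.
apply: (eq_integrable _
    (Radon_Nikodym (charge_of_finite_measure N) mu)) => // [x _|].
  by rewrite -densityE.
exact: Radon_Nikodym_integrable.
Qed.

Lemma measurable_density : measurable_fun [set: X] n.
Proof. exact/measurable_EFinP/(measurable_int mu)/integrable_density. Qed.

Lemma integral_density U : measurable U -> \int[mu]_(x in U) (n x)%:E = N U.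
Proof.
move=> mU; rewrite -[RHS]/(charge_of_finite_measure N U).
rewrite (Radon_Nikodym_integral
  (nu := charge_of_finite_measure N) (mu := mu))//.
by apply: eq_integral => x _; rewrite densityE.
Qed.

(** The set where the density is negative has nonpositive [N]-mass, hence the
    density, which is negative there, integrates to zero over it. *)
Lemma density_ae_ge0 : {ae mu, forall x, (0 <= n x)%R}.
Proof.
pose B := [set x | (n x < 0)%R].
have mB : measurable B.
  rewrite -[B]setTI.
  have := @measurable_density measurableT `]-oo, 0%R[%classic.
  by rewrite set_itvE; apply; exact: open_measurable.
have intB : mu.-integrable B (EFin \o n).
  exact: integrableS integrable_density.
have : \int[mu]_(x in B) `|(n x)%:E| = 0.
  apply/eqP; rewrite eq_le; apply/andP; split; last exact: integral_ge0.
  have -> : \int[mu]_(x in B) `|(n x)%:E| = - N B.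
    rewrite -integral_density// -integralN//=; last first.
      exact: integrable_add_def.
    by apply: eq_integral => x; rewrite inE => /ltW nx; rewrite ler0_norm.
  by rewrite oppe_le0 measure_ge0.
move/(ae_eq_integral_abs _ mB (measurable_int mu intB)).
apply: filterS => x nB; rewrite leNgt; apply/negP => nx0.
by have [nx] := nB nx0; rewrite nx ltxx in nx0.
Qed.

Lemma integrable_density_indic (c : R) U : measurable U ->
  mu.-integrable [set: X] (fun x => (c * n x * \1_U x)%:E).
Proof.
move=> mU.
apply: (eq_integrable _ (fun x => c%:E * ((EFin \o n) \_ U) x)) => //.
  move=> x _; rewrite patchE indicE; case: ifPn => _ /=.
    by rewrite mulr1 EFinM.
  by rewrite mulr0 mule0.
apply: integrableZl => //; apply/(integrable_mkcond _ mU).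
exact: integrableS integrable_density.
Qed.

Lemma integral_density_indic (c : R) U : measurable U ->
  \int[mu]_x (c * n x * \1_U x)%:E = c%:E * N U.
Proof.
move=> mU; rewrite -integral_density// -integralZl//; last first.
  exact: integrableS integrable_density.
rewrite [RHS]integral_mkcond; apply: eq_integral => x _.
rewrite patchE indicE; case: ifPn => _; last by rewrite mulr0.
by rewrite mulr1 EFinM.
Qed.

End densities.

(** * A variational lower bound on f-divergences *)

(** The condition on the slope at infinity is what the line contributes on the
    part of [P] that is singular to [Q]. In terms of the convex conjugate, the
    inequality says that [- a] is at least [f^*(alpha)]. *)
Definition affine_minorant (R : realType) (f : R -> R) (alpha a : R) :=
  alpha%:E <= f_slope f /\ forall u : R, (0 <= u)%R -> (alpha * u + a <= f u)%R.

Section fdiv_lower_bound.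
Context d (X : measurableType d) (R : realType) (P Q : probability X R).
Variables (f : R -> R) (alpha beta a b : R) (E : set X).
Hypothesis f0 : f_at0 f = (f 0%R)%:E.
Hypothesis fa : affine_minorant f alpha a.
Hypothesis fb : affine_minorant f beta b.
Hypothesis mE : measurable E.

Let mu := sum_measure P Q.
Let p := density P Q P.
Let q := density P Q Q.
Let Z := [set x | q x = 0%R].

Let f_extE u : f_ext f u = (f u)%:E.
Proof. by rewrite /f_ext; case: eqVneq => [->|]. Qed.

Let mZ : measurable Z.
Proof.
rewrite -[Z]setTI.
exact: (measurable_density (sum_measure_dominates P Q).2 measurableT
  (measurable_set1 0%R)).
Qed.

(* On [Z] the density [q] vanishes and the contribution of [P] is accounted for
   by the slope of [f] at infinity, so [p] is cut off there. *)
Let tangent_integrand x : \bar R :=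
  (alpha * p x * \1_(E `\` Z) x)%:E + (beta * p x * \1_(~` E `\` Z) x)%:E
  + ((a * q x * \1_E x)%:E + (b * q x * \1_(~` E) x)%:E).

Let le_tangent_integrand x : (0 <= p x)%R -> (0 <= q x)%R ->
  tangent_integrand x <= f_ext f (p x / q x) * (q x)%:E.
Proof.
move=> p0 q0; rewrite f_extE -EFinM /tangent_integrand -!EFinD lee_fin !indicE.
rewrite !in_setD !in_setC.
case: (eqVneq (q x) 0%R) => [qx0|qx0].
  have -> : x \in Z by rewrite inE.
  by rewrite !andbF qx0 !(mulr0, mul0r, addr0).
have -> : (x \in Z) = false by apply: memNset => /eqP; rewrite (negbTE qx0).
have qp : (0 < q x)%R by rewrite lt_neqAle eq_sym qx0.
have u0 : (0 <= p x / q x)%R by rewrite divr_ge0.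
have pE : p x = (p x / q x * q x)%R by rewrite divfK.
have [xE|xE] := boolP (x \in E); rewrite /= !(mulr0, mulr1, addr0, add0r).
  apply: le_trans (ler_wpM2r q0 (fa.2 _ u0)); rewrite [in leLHS]pE; lra.
apply: le_trans (ler_wpM2r q0 (fb.2 _ u0)); rewrite [in leLHS]pE; lra.
Qed.

(** On [q > 0] the line evaluated at [p / q] and multiplied by [q] gives
    [alpha * p + a * q]; on [q = 0] the term [f_slope f * P Z] dominates
    [alpha * P (E `&` Z) + beta * P (~` E `&` Z)]. *)
Lemma fdiv_ge :
  alpha%:E * P E + beta%:E * P (~` E) + (a%:E * Q E + b%:E * Q (~` E))
  <= fdiv f P Q.
Proof.
have [PM QM] := sum_measure_dominates P Q.
have mEZ : measurable (E `\` Z) by exact: measurableD.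
have mE' : measurable (~` E) by exact: measurableC.
have mE'Z : measurable (~` E `\` Z) by exact: measurableD.
have intp c U := integrable_density_indic PM c (U := U).
have intq c U := integrable_density_indic QM c (U := U).
have int1 := integrableD measurableT (intp alpha _ mEZ) (intp beta _ mE'Z).
have int2 := integrableD measurableT (intq a _ mE) (intq b _ mE').
have le_int : alpha%:E * P (E `\` Z) + beta%:E * P (~` E `\` Z)
    + (a%:E * Q E + b%:E * Q (~` E))
    <= \int[mu]_x (f_ext f (p x / q x) * (q x)%:E).
  rewrite -!(integral_density_indic PM)// -!(integral_density_indic QM)//.
  rewrite -!integralD//; [|exact: intq|exact: intq|exact: intp|exact: intp].
  apply: le_integral_nonmeasurable.
    exact: measurable_int (integrableD measurableT int1 int2).
  apply: filterS2 (density_ae_ge0 PM) (density_ae_ge0 QM) => x.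
  exact: le_tangent_integrand.
have le_sing : alpha%:E * P (E `&` Z) + beta%:E * P (~` E `&` Z)
    <= f_slope f * P Z.
  have -> : P Z = P (E `&` Z) + P (~` E `&` Z).
    rewrite -measureU//; [|exact: measurableI|exact: measurableI|].
      by rewrite -setIUl setUv setTI.
    by rewrite setIACA setICr set0I.
  rewrite ge0_muleDr//; apply: leeD; apply: lee_wpmul2r => //.
    exact: fa.1.
  exact: fb.1.
have finP U : measurable U -> P U \is a fin_num.
  by move=> mU; exact: fin_num_measure.
have mIZ : measurable (E `&` Z) by exact: measurableI.
have mI'Z : measurable (~` E `&` Z) by exact: measurableI.
apply: le_trans (leeD le_int le_sing).
have -> : P E = P (E `\` Z) + P (E `&` Z) := measureDI P mE mZ.
have -> : P (~` E) = P (~` E `\` Z) + P (~` E `&` Z) := measureDI P mE' mZ.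
rewrite -(fineK (finP _ mEZ)) -(fineK (finP _ mE'Z)).
rewrite -(fineK (finP _ mIZ)) -(fineK (finP _ mI'Z)).
rewrite -[Q E]fineK ?fin_num_measure// -[Q (~` E)]fineK ?fin_num_measure//.
rewrite -!(EFinM, EFinD) lee_fin; lra.
Qed.

End fdiv_lower_bound.

(** * Averaging over the prior *)

Lemma integral_probability_cst d (T : measurableType d) (R : realType)
    (P : probability T R) (r : \bar R) : \int[P]_x cst r x = r.
Proof.
rewrite integral_cst//; have := @probability_setT _ _ _ P => /= PT.
by rewrite -[RHS]mule1; congr (_ * _).
Qed.

Section family_kernel.
Context dT dX (Theta : measurableType dT) (X : measurableType dX)
  (R : realType) (P : Theta -> probability X R).

(** The proof [mP] is an argument so that the kernel structure below can be
    attached to the function. *)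
Definition family_kernel (mP : forall U, measurable U ->
    measurable_fun [set: Theta] (fun th => P th U)) :
  Theta -> {measure set X -> \bar R} := fun th => P th.

Hypothesis mP : forall U : set X, measurable U ->
  measurable_fun [set: Theta] (fun th => P th U).

HB.instance Definition _ :=
  isKernel.Build _ _ Theta X R (family_kernel mP) mP.

Let family_kernel_setT th : family_kernel mP th [set: X] = 1.
Proof. exact: probability_setT. Qed.

HB.instance Definition _ :=
  Kernel_isProbability.Build _ _ Theta X R
    (family_kernel mP) family_kernel_setT.

Lemma measurable_probability_xsection (C : set (Theta * X)) : measurable C ->
  measurable_fun [set: Theta] (fun th => P th (xsection C th)).
Proof.
move=> mC.
apply: (measurable_fun_xsection_finite_kernel (family_kernel mP)).
by rewrite inE.
Qed.

End family_kernel.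

Lemma integrable_probability_xsection dT dX (Theta : measurableType dT)
    (X : measurableType dX) (R : realType) (w : probability Theta R)
    (P : Theta -> probability X R) (C : set (Theta * X)) :
  (forall U, measurable U -> measurable_fun [set: Theta] (fun th => P th U)) ->
  measurable C ->
  w.-integrable [set: Theta] (fun th => P th (xsection C th)).
Proof.
move=> mP mC.
apply: (le_integrable measurableT (g := cst 1)) => //.
- exact: measurable_probability_xsection.
- move=> th _ /=; rewrite normr1 gee0_abs ?measure_ge0//.
  exact/probability_le1/measurable_xsection.
- exact: finite_measure_integrable_cst.
Qed.

Section average.
Context dT dX (Theta : measurableType dT) (X : measurableType dX)
  (R : realType) (w : probability Theta R) (P : Theta -> probability X R).
Hypothesis mP : forall U : set X, measurable U ->
  measurable_fun [set: Theta] (fun th => P th U).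
Variables (C : set (Theta * X)).
Hypothesis mC : measurable C.
Variables (f : R -> R) (alpha beta a b : R).
Hypothesis f0 : f_at0 f = (f 0%R)%:E.
Hypothesis fa : affine_minorant f alpha a.
Hypothesis fb : affine_minorant f beta b.

(** The bound [fdiv_ge] for the event [xsection C th], rewritten with
    [P (~` E) = 1 - P E] and integrated in [th]. *)
Lemma average_fdiv_ge (Q : probability X R) :
  (beta + b)%:E + (alpha - beta)%:E * \int[w]_th P th (xsection C th)
    + (a - b)%:E * \int[w]_th Q (xsection C th)
  <= \int[w]_th fdiv f (P th) Q.
Proof.
have intP := integrable_probability_xsection w mP mC.
have intQ : w.-integrable [set: Theta] (fun th => Q (xsection C th)).
  by apply: (integrable_probability_xsection w (P := fun=> Q)).
have int0 : w.-integrable [set: Theta] (cst (beta + b)%:E).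
  exact: finite_measure_integrable_cst.
have intP' := integrableZl measurableT (alpha - beta) intP.
have intQ' := integrableZl measurableT (a - b) intQ.
have int1 := integrableD measurableT int0 intP'.
rewrite -!integralZl//.
have <- : \int[w]_th cst (beta + b)%:E th = (beta + b)%:E.
  exact: integral_probability_cst.
rewrite -!integralD//.
apply: le_integral_nonmeasurable.
  exact: measurable_int (integrableD measurableT int1 intQ').
apply: aeW => th /=.
have mx := measurable_xsection th mC.
apply: le_trans (fdiv_ge (P th) Q f0 fa fb mx).
rewrite !probability_setC//.
rewrite -[P th _]fineK ?fin_num_measure// -[Q _]fineK ?fin_num_measure//.
rewrite -!(EFinM, EFinD, EFinB) lee_fin; lra.
Qed.

(** Tonelli: averaging over [th] the [Q]-mass of the sections of [C] is the
    same as averaging over [x] the prior mass of its other sections. *)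
Lemma average_xsection_le (Q : probability X R) (s : R) :
  (forall x, w (ysection C x) <= s%:E) ->
  \int[w]_th Q (xsection C th) <= s%:E.
Proof.
move=> ws.
have -> : \int[w]_th Q (xsection C th) = \int[Q]_x w (ysection C x).
  have := indic_fubini_tonelli w Q mC.
  by rewrite indic_fubini_tonelli_FE// indic_fubini_tonelli_GE.
rewrite -[leRHS](_ : \int[Q]_x (cst s%:E) x = _); last first.
  exact: integral_probability_cst.
apply: ge0_le_integral_nonmeasurable => // x; exact: measure_ge0.
Qed.

(** The average bound is nondecreasing in the mass given by [P] (as
    [beta <= alpha]) and nonincreasing in the mass given by [Q] (as [a <= b]),
    so it is smallest at [1/2] and [s]. *)
Lemma f_informativity_ge (s : R) :
  (beta <= alpha)%R -> (a <= b)%R ->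
  (2^-1)%:E <= \int[w]_th P th (xsection C th) ->
  (forall x, w (ysection C x) <= s%:E) ->
  ((alpha + beta) / 2 + a * s + b * (1 - s))%:E <= f_informativity f w P.
Proof.
move=> ba ab p2 ws; apply/ereal_infP => _ [Q _ <-].
apply: le_trans (average_fdiv_ge Q).
have q_le := average_xsection_le Q ws.
have intP := integrable_probability_xsection w mP mC.
have intQ : w.-integrable [set: Theta] (fun th => Q (xsection C th)).
  by apply: (integrable_probability_xsection w (P := fun=> Q)).
have /fineK pE := integrable_fin_num measurableT intP.
have /fineK qE := integrable_fin_num measurableT intQ.
move: p2 q_le; rewrite -pE -qE -!(EFinM, EFinD) !lee_fin; nra.
Qed.

End average.

(** A line through [(1, 0)] below [f] bounds every divergence by
    [alpha - alpha = 0]. *)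
Lemma f_informativity_ge0 dT dX (Theta : measurableType dT)
    (X : measurableType dX) (R : realType) (w : probability Theta R)
    (P : Theta -> probability X R) (f : R -> R) (alpha : R) :
  (forall U : set X, measurable U ->
    measurable_fun [set: Theta] (fun th => P th U)) ->
  f_at0 f = (f 0%R)%:E -> affine_minorant f alpha (- alpha) ->
  0 <= f_informativity f w P.
Proof.
move=> mP f0 fa; apply/ereal_infP => _ [Q _ <-].
apply: le_trans (average_fdiv_ge w mP measurable0 f0 fa fa Q).
by rewrite !subrr !mul0e !adde0.
Qed.

(** * From the informativity to the Bayes risk *)

Section risk.
Context dT dX dA (Theta : measurableType dT) (X : measurableType dX)
  (A : measurableType dA) (R : realType)
  (w : probability Theta R) (P : Theta -> probability X R)
  (L : Theta -> A -> R).
Hypothesis mP : forall U : set X, measurable U ->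
  measurable_fun [set: Theta] (fun th => P th U).
Hypothesis L_ge0 : forall th a, (0 <= L th a)%R.
Hypothesis mL : measurable_fun [set: Theta * A]
  (fun z : Theta * A => L z.1 z.2).

Definition small_loss (dec : X -> A) (t : R) : set (Theta * X) :=
  [set z | (L z.1 (dec z.2) < t)%R].

Lemma measurable_small_loss (dec : {mfun X >-> A}) t :
  measurable (small_loss dec t).
Proof.
have mLd : measurable_fun [set: Theta * X] (fun z => L z.1 (dec z.2)).
  apply: (measurableT_comp mL (g := fun z : Theta * X => (z.1, dec z.2))).
  by apply: measurable_fun_pair => //; exact: measurableT_comp.
rewrite -[small_loss _ _]setTI.
have := mLd measurableT `]-oo, t[%classic.
by rewrite set_itvE; apply; exact: open_measurable.
Qed.

(** Markov's inequality for each [th], then integrated over the prior. *)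
Lemma markov_risk (dec : {mfun X >-> A}) (t : R) : (0 < t)%R ->
  t%:E * (1 - \int[w]_th P th (xsection (small_loss dec t) th))
  <= \int[w]_th 'E_(P th)[fun x => L th (dec x)].
Proof.
move=> t0; have mC := measurable_small_loss dec t.
set C := small_loss dec t in mC *.
have intP := integrable_probability_xsection w mP mC.
have intP' := integrableZl measurableT (- t) intP.
have /fineK pE := integrable_fin_num measurableT intP.
have int0 : w.-integrable [set: Theta] (cst t%:E).
  exact: finite_measure_integrable_cst.
have -> : t%:E * (1 - \int[w]_th P th (xsection C th)) =
    \int[w]_th (cst t%:E th + (- t)%:E * P th (xsection C th)).
  rewrite integralD// integral_probability_cst integralZl//.
  by rewrite -pE -!(EFinM, EFinD, EFinB); congr (_%:E); lra.
apply: le_integral_nonmeasurable.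
  exact: measurable_int (integrableD measurableT int0 intP').
apply: aeW => th /=; have mx := measurable_xsection th mC.
have mx' : measurable (~` xsection C th) by exact: measurableC.
have -> : t%:E + (- t)%:E * P th (xsection C th) =
    \int[P th]_x (t%:E * (\1_(~` xsection C th) x)%:E).
  rewrite ge0_integralZl//; last 2 first.
  - exact/measurable_EFinP.
  - by rewrite lee_fin ltW.
  rewrite integral_indic// setIT -[X in _ = _ * X]/(P th (~` _)).
  rewrite probability_setC//.
  rewrite -[P th _]fineK ?fin_num_measure//.
  by rewrite -!(EFinM, EFinD, EFinB); congr (_%:E); lra.
rewrite unlock; apply: ge0_le_integral_nonmeasurable => x.
  by rewrite -EFinM lee_fin mulr_ge0// ltW.
rewrite -EFinM lee_fin indicE in_setC.
have [_|] := boolP (x \in _); first by rewrite mulr0.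
rewrite mulr1 mem_xsection notin_setE /C/small_loss/= => /negP.
by rewrite -leNgt.
Qed.

(** The pairs of lines in the second hypothesis are certificates that the
    average success probability of the test [small_loss dec t] cannot
    exceed [1/2]. They are required only for positive [s], because there is
    room for a positive real between the small-ball probability and [c]; this
    keeps the tangency point [(1/2) / s] finite. *)
Lemma Bayes_risk_ge (f : R -> R) (c : \bar R) :
  f_at0 f = (f 0%R)%:E ->
  (forall s : R, (0 < s)%R -> s%:E < c -> exists alpha beta a b,
    [/\ affine_minorant f alpha a, affine_minorant f beta b,
        (beta <= alpha)%R, (a <= b)%R &
        f_informativity f w P
        < ((alpha + beta) / 2 + a * s + b * (1 - s))%:E]) ->
  (2^-1)%:E * sup_radius w L c <= Bayes_risk w P L.
Proof.
move=> f0 cert; apply/ereal_infP => _ [dec _ <-].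
have risk_ge0 : 0 <= \int[w]_th 'E_(P th)[fun x => L th (dec x)].
  apply: integral_ge0 => th _; rewrite unlock.
  by apply: integral_ge0 => x _; rewrite lee_fin.
rewrite /sup_radius; set radii := (X in Defs.sup0 X).
rewrite /Defs.sup0; case: ifPn => [_|_]; first by rewrite mule0.
rewrite lee_pdivrMl//.
apply/ereal_supP => _ [t [t0 +] <-].
rewrite /Defs.sup0 ifF; last first.
  apply/negbTE/set0P; exists (w (loss_ball L t (dec point))).
  by exists (dec point).
move=> ball_lt; rewrite -lee_pdivrMl//.
set sigma := ereal_sup _ in ball_lt.
have ball_le x : w (ysection (small_loss dec t) x) <= sigma.
  have -> : ysection (small_loss dec t) x = loss_ball L t (dec x).
    by apply/seteqP; split => th; rewrite /ysection/= inE.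
  by apply: ereal_sup_ubound; exists (dec x).
have mC := measurable_small_loss dec t.
(* [s] is the midpoint of [sigma] and [c] when [c] is finite. *)
have [s [s0 sc ws]] : exists s : R, [/\ (0 < s)%R, s%:E < c &
    forall x, w (ysection (small_loss dec t) x) <= s%:E].
  have sigma0 : 0 <= sigma by exact: le_trans (ball_le point).
  have sigma_fin : sigma \is a fin_num.
    by rewrite ge0_fin_numE// (lt_le_trans ball_lt)// leey.
  move: sigma0 ball_le ball_lt; rewrite -(fineK sigma_fin).
  move: (fine sigma) => r; rewrite lee_fin => r0 ball_le.
  case: c {radii} cert => [c| |] cert //.
    rewrite lte_fin => rc; exists ((r + c) / 2)%R; rewrite lte_fin.
    split; [lra|lra|] => x; apply: le_trans (ball_le x) _.
    by rewrite lee_fin; lra.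
  move=> _; exists (r + 1)%R; rewrite ltry; split => //; first lra.
  by move=> x; apply: le_trans (ball_le x) _; rewrite lee_fin; lra.
have p_le : \int[w]_th P th (xsection (small_loss dec t) th) <= (2^-1)%:E.
  rewrite leNgt; apply/negP => /ltW p2.
  have [al [be [a [b [fa fb ba ab]]]]] := cert s s0 sc.
  rewrite ltNge => /negP; apply.
  exact: (f_informativity_ge mP mC f0 fa fb ba ab p2 ws).
apply: le_trans (markov_risk dec t0).
have intP := integrable_probability_xsection w mP mC.
have /fineK pE := integrable_fin_num measurableT intP.
move: p_le; rewrite -pE -!(EFinM, EFinB) !lee_fin; nra.
Qed.

End risk.

(** * Behaviour of the four functions at zero and at infinity *)

Section limits.
Variable R : realType.
Implicit Types f : R -> R.

Lemma f_at0_fin f (l : R) :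
  (forall e : R, (0 < e)%R -> exists2 delta : R, (0 < delta)%R &
    forall x : R, (0 < x < delta)%R -> (`|l - f x| <= e)%R) ->
  f_at0 f = l%:E.
Proof.
move=> fl; apply/cvg_lim => //; apply: cvg_EFin; first exact: nearW.
apply/cvgrPdist_le => e /fl[delta d0 fd].
near=> x; apply: fd; apply/andP; split; first by [].
by near: x; exact: nbhs_right_lt.
Unshelve. all: by end_near. Qed.

Lemma f_slope_fin f (l : R) :
  (forall e : R, (0 < e)%R -> exists M : R,
    forall x : R, (M < x)%R -> (`|l - f x / x| <= e)%R) ->
  f_slope f = l%:E.
Proof.
move=> fl; apply/cvg_lim => //; apply: cvg_EFin; first exact: nearW.
apply/cvgrPdist_le => e /fl[M fM].
by near=> x; apply: fM; near: x; apply: nbhs_pinfty_gt; exact: num_real.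
Unshelve. all: by end_near. Qed.

Lemma f_slope_pinfty f :
  (forall B : R, exists M : R, forall x : R, (M < x)%R -> (B <= f x / x)%R) ->
  f_slope f = +oo.
Proof.
move=> fl; apply/cvg_lim => //; apply/cvgeyPge => B.
have [M fM] := fl B.
near=> x; rewrite lee_fin; apply: fM.
by near: x; apply: nbhs_pinfty_gt; exact: num_real.
Unshelve. all: by end_near. Qed.

(** With [y] the square root of [x], [- x * ln x = 2 * y^2 * ln (1 / y)], which
    is at most [2 * y] because [ln] is sublinear. *)
Lemma f_KL_at0 : f_at0 (@f_KL R) = (f_KL 0%R)%:E.
Proof.
apply: f_at0_fin => e e0; exists (Num.min 1 ((e / 2) ^+ 2))%R.
  by rewrite lt_min ltr01 exprn_gt0// divr_gt0.
move=> x /andP[x0]; rewrite lt_min => /andP[x1 xe].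
pose y := Num.sqrt x.
have y0 : (0 < y)%R by rewrite sqrtr_gt0.
have xE : x = (y ^+ 2)%R by rewrite sqr_sqrtr// ltW.
have ye : (y < e / 2)%R.
  by rewrite -(ltr_pXn2r (n := 2))// ?nnegrE ?ltW ?divr_gt0// -xE.
have y1 : (y < 1)%R.
  by rewrite -(ltr_pXn2r (n := 2))// ?nnegrE ?ltW// expr1n -xE.
have lny : (- ln y < y^-1)%R.
  by rewrite -lnV ?posrE//; apply: ln_sublinear; rewrite invr_gt0.
have lny0 : (ln y <= 0)%R by apply: ln_le0; exact: ltW.
have yV : (y * y^-1 = 1)%R by rewrite divff// gt_eqF.
rewrite /f_KL mul0r sub0r normrN xE lnXn// mulr2n ler_norml.
apply/andP; split; nra.
Qed.

Lemma f_chi2_at0 : f_at0 (@f_chi2 R) = (f_chi2 0%R)%:E.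
Proof.
apply: f_at0_fin => e e0; exists (Num.min 1 e)%R; first by rewrite lt_min ltr01.
move=> x /andP[x0]; rewrite lt_min => /andP[x1 xe].
by rewrite /f_chi2 expr0n/= ler_norml; apply/andP; split; nra.
Qed.

Lemma f_TV_at0 : f_at0 (@f_TV R) = (f_TV 0%R)%:E.
Proof.
apply: f_at0_fin => e e0; exists (Num.min 1 e)%R; first by rewrite lt_min ltr01.
move=> x /andP[x0]; rewrite lt_min => /andP[x1 xe].
rewrite /f_TV sub0r normrN1 (ler0_norm (x := (x - 1)%R)); last lra.
by rewrite ler_norml; apply/andP; split; lra.
Qed.

Lemma f_Hellinger_at0 : f_at0 (@f_Hellinger R) = (f_Hellinger 0%R)%:E.
Proof.
apply: f_at0_fin => e e0; exists (e ^+ 2)%R; first exact: exprn_gt0.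
move=> x /andP[x0 xe].
have ye : (Num.sqrt x < e)%R.
  by rewrite -(ltr_pXn2r (n := 2))// ?nnegrE ?sqrtr_ge0 ?sqr_sqrtr// ltW.
rewrite /f_Hellinger sqrtr0 ger0_norm; first lra.
by have := sqrtr_ge0 x; lra.
Qed.

Lemma f_KL_slope : f_slope (@f_KL R) = +oo.
Proof.
apply: f_slope_pinfty => B; exists (expR B) => x Bx.
have x0 : (0 < x)%R by exact: lt_trans (expR_gt0 B) Bx.
rewrite /f_KL mulrAC divff ?gt_eqF// mul1r -[leLHS]expRK.
by rewrite ler_ln ?posrE ?expR_gt0// ltW.
Qed.

Lemma f_chi2_slope : f_slope (@f_chi2 R) = +oo.
Proof.
apply: f_slope_pinfty => B; exists (Num.max 1 (B + 1))%R => x.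
rewrite gt_max => /andP[x1 xB].
by rewrite /f_chi2 ler_pdivlMr; nra.
Qed.

Lemma f_TV_slope : f_slope (@f_TV R) = (2^-1)%:E.
Proof.
apply: f_slope_fin => e e0; exists (Num.max 1 (e^-1))%R => x.
rewrite gt_max => /andP[x1 xe].
have x0 : (0 < x)%R by lra.
rewrite /f_TV (ger0_norm (x := (x - 1)%R)); last lra.
have -> : (2^-1 - (x - 1) / 2 / x = (2 * x)^-1)%R by field; rewrite gt_eqF.
rewrite ger0_norm; last by rewrite invr_ge0; lra.
rewrite -[leRHS]invrK lef_pV2 ?posrE; [lra|lra|by rewrite invr_gt0].
Qed.

Lemma f_Hellinger_slope : f_slope (@f_Hellinger R) = 0.
Proof.
apply: f_slope_fin => e e0; exists (Num.max 1 (e^-1 ^+ 2))%R => x.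
rewrite gt_max => /andP[x1 xe].
pose y := Num.sqrt x.
have xE : x = (y ^+ 2)%R by rewrite sqr_sqrtr//; lra.
have y1 : (1 < y)%R by rewrite -[1%R](@sqrtr1 R) ltr_sqrt//; lra.
have ye : (e^-1 < y)%R.
  by rewrite -(ltr_pXn2r (n := 2))// ?nnegrE ?invr_ge0 ?sqrtr_ge0 ?ltW// -xE.
have ey : (1 < e * y)%R.
  by rewrite -(ltr_pM2l e0) divff ?gt_eqF in ye.
rewrite /f_Hellinger sub0r -mulNr opprB -/y ger0_norm; last first.
  by rewrite divr_ge0//; lra.
rewrite ler_pdivrMr; last lra.
rewrite [in leRHS]xE; nra.
Qed.

End limits.

Section tangent_lines.
Variable R : realType.

(** The tangent line at [u0], from [ln v <= v - 1] at [v = u0 / u]. *)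
Lemma f_KL_minorant (u0 : R) : (0 < u0)%R ->
  affine_minorant (@f_KL R) (1 + ln u0) (- u0).
Proof.
move=> u00; split; first by rewrite f_KL_slope leey.
move=> u; rewrite le_eqVlt => /predU1P[<-|u_gt0]; first by rewrite /f_KL; lra.
have : (ln (1 + (u0 / u - 1)) <= u0 / u - 1)%R.
  by apply: le_ln1Dx; rewrite ltrBDr addNr divr_gt0.
rewrite addrC subrK ln_div ?posrE// => lnu.
have := ler_wpM2l (ltW u_gt0) lnu.
have -> : (u * (u0 / u - 1) = u0 - u)%R by field; rewrite gt_eqF.
rewrite /f_KL; lra.
Qed.

(** The tangent line at [u0], from [0 <= (u - u0)^2]. *)
Lemma f_chi2_minorant (u0 : R) :
  affine_minorant (@f_chi2 R) (2 * u0) (- (u0 ^+ 2 + 1)).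
Proof.
split=> [|u _]; first by rewrite f_chi2_slope leey.
by rewrite /f_chi2; have := sqr_ge0 (u - u0); nra.
Qed.

(** The lines supporting the absolute value at its kink [u = 1]. *)
Lemma f_TV_minorant (alpha : R) : (`|alpha| <= 2^-1)%R ->
  affine_minorant (@f_TV R) alpha (- alpha).
Proof.
rewrite ler_norml => /andP[al ag]; split=> [|u _].
  by rewrite f_TV_slope lee_fin.
rewrite /f_TV; have [u1|u1] := leP 0%R (u - 1)%R.
  by rewrite ger0_norm//; nra.
by rewrite ltr0_norm//; nra.
Qed.

(** The tangent line at [u = y^-2], from [0 <= (v * y - 1)^2] with [v] the
    square root of [u]. *)
Lemma f_Hellinger_minorant (y : R) : (0 < y)%R ->
  affine_minorant (@f_Hellinger R) (- (y / 2)) (1 - (2 * y)^-1).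
Proof.
move=> y0; split=> [|u u0].
  by rewrite f_Hellinger_slope lee_fin; lra.
pose v := Num.sqrt u.
have uE : u = (v ^+ 2)%R by rewrite sqr_sqrtr.
have sq := sqr_ge0 (v * y - 1)%R.
rewrite /f_Hellinger -/v uE -subr_ge0.
have -> : (1 - v - (- (y / 2) * v ^+ 2 + (1 - (2 * y)^-1)) =
  (v * y - 1) ^+ 2 / (2 * y))%R by field; rewrite gt_eqF.
by rewrite divr_ge0//; lra.
Qed.

End tangent_lines.

(** * The four bounds *)

(** Put [h = 1 - I], and let [y] and [z] be the two square roots of the
    conclusion, so that [y^2 + z^2 = 2]. If [y + z >= 2 * h] then
    [y * z >= 2 * h^2 - 1], which is positive by the bound on [I]; squaring
    gives [(1 - 2 * s)^2 <= 4 * h^2 * (1 - h^2)], and [1 - h^2 = I * (2 - I)],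
    so [s] is not below the threshold. *)
Lemma Hellinger_threshold (R : realType) (I s : R) :
  (0 <= I)%R -> (I < 1 - (Num.sqrt 2)^-1)%R -> (0 < s)%R ->
  (s < 2^-1 - (1 - I) * Num.sqrt (I * (2 - I)))%R ->
  (s < 2^-1)%R /\
  (I < 1 - (Num.sqrt (2 * s) + Num.sqrt (2 * (1 - s))) / 2)%R.
Proof.
move=> I0 I1 s0 sI.
set h := (1 - I)%R in sI *; set k := Num.sqrt _ in sI.
have k0 : (0 <= k)%R by exact: sqrtr_ge0.
have r2 : (0 < Num.sqrt 2 :> R)%R by rewrite sqrtr_gt0.
have hV : ((Num.sqrt 2)^-1 < h)%R by rewrite /h; lra.
have h0 : (0 < h)%R by apply: lt_trans hV; rewrite invr_gt0.
have h2 : (1 < 2 * h ^+ 2)%R.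
  have : (1 < h * Num.sqrt 2)%R.
    by rewrite -ltr_pdivrMr// mul1r.
  have := sqr_sqrtr (ler0n R 2); nra.
have k2 : (k ^+ 2 = 1 - h ^+ 2)%R.
  rewrite sqr_sqrtr; first by rewrite /h; ring.
  by apply: mulr_ge0 => //; rewrite /h in h0; lra.
have hk : (0 <= h * k)%R by apply: mulr_ge0 => //; exact: ltW.
have s1 : (s < 2^-1)%R by lra.
split=> //.
set y := Num.sqrt (2 * s); set z := Num.sqrt (2 * (1 - s)).
have y0 : (0 <= y)%R by exact: sqrtr_ge0.
have z0 : (0 <= z)%R by exact: sqrtr_ge0.
have y2 : (y ^+ 2 = 2 * s)%R by rewrite sqr_sqrtr//; lra.
have z2 : (z ^+ 2 = 2 * (1 - s))%R by rewrite sqr_sqrtr//; lra.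
suff : (y + z < 2 * h)%R by rewrite /h; lra.
rewrite ltNge; apply/negP => hyz.
have yz : (2 * h ^+ 2 - 1 <= y * z)%R.
  have : ((2 * h) ^+ 2 <= (y + z) ^+ 2)%R.
    by rewrite ler_pXn2r// nnegrE; [lra|exact: addr_ge0].
  rewrite sqrrD y2 z2 exprMn; lra.
have yz2 : ((2 * h ^+ 2 - 1) ^+ 2 <= (y * z) ^+ 2)%R.
  by rewrite ler_pXn2r// nnegrE; [lra|exact: mulr_ge0].
have hks : ((2 * (h * k)) ^+ 2 < (1 - 2 * s) ^+ 2)%R.
  by rewrite ltr_pXn2r// ?nnegrE; lra.
move: yz2 hks; rewrite !exprMn y2 z2 k2 => yz2 hks; nra.
Qed.

Section corollaries.
Context dT dX dA (Theta : measurableType dT) (X : measurableType dX)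
  (A : measurableType dA) (R : realType)
  (w : probability Theta R) (P : Theta -> probability X R)
  (L : Theta -> A -> R).
Hypothesis mP : forall U : set X, measurable U ->
  measurable_fun [set: Theta] (fun th => P th U).
Hypothesis L_ge0 : forall th a, (0 <= L th a)%R.
Hypothesis mL : measurable_fun [set: Theta * A]
  (fun z : Theta * A => L z.1 z.2).

Lemma Bayes_risk_KL (Iup : \bar R) :
  f_informativity (@f_KL R) w P <= Iup ->
  (2^-1)%:E * sup_radius w L ((4^-1)%:E * expeR (- (2%:E * Iup)))
  <= Bayes_risk w P L.
Proof.
move=> infI; apply: (Bayes_risk_ge mP L_ge0 mL (f_KL_at0 R)) => s s0.
have I0 : 0 <= Iup.
  apply: le_trans infI; apply: (f_informativity_ge0 (alpha := 1%R) w mP).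
    exact: f_KL_at0.
  by have := f_KL_minorant (@ltr01 R); rewrite ln1 addr0.
case: Iup I0 infI => [I| |]//; last first.
  by move=> _ _; rewrite gt0_muley//= mule0 lte_fin ltNge ltW.
rewrite lee_fin => I0 infI.
have -> : expeR (- (2%:E * I%:E)) = (expR (- (2 * I)))%:E by [].
rewrite -EFinM lte_fin => sI.
have sE : (4 * s < expR (- (2 * I)))%R by lra.
have s1 : (4 * s < 1)%R.
  by apply: lt_le_trans sE _; rewrite -[leRHS]expR0 ler_expR; lra.
have lns : (ln (4 * s) < - (2 * I))%R.
  by rewrite -[ltRHS]expRK ltr_ln// posrE ?expR_gt0//; lra.
have u0 : (0 < (2 * s)^-1 :> R)%R by rewrite invr_gt0; lra.
have h0 : (0 < 2^-1 :> R)%R by lra.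
have hu : (2^-1 <= (2 * s)^-1 :> R)%R by rewrite lef_pV2 ?posrE; lra.
(* The tangent at the likelihood ratio [1 / (2 * s)], and the tangent at [1/2],
   which replaces the optimal [1 / (2 * (1 - s))]: the threshold loses the
   factor [1 - s] anyway. *)
exists (1 + ln (2 * s)^-1)%R, (1 + ln 2^-1)%R, (- (2 * s)^-1)%R, (- 2^-1)%R.
split; [exact: f_KL_minorant|exact: f_KL_minorant| | |].
- by rewrite lerD2l ler_ln ?posrE.
- by rewrite lerN2.
- apply: le_lt_trans infI _; rewrite lte_fin.
  have -> : (- (2 * s)^-1 * s = - 2^-1 :> R)%R by field; rewrite gt_eqF.
  have : (ln (2 * s)^-1 + ln 2^-1 = - ln (4 * s) :> R)%R.
    rewrite -lnM ?posrE// -invfM lnV ?posrE; last lra.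
    by congr (- ln _)%R; ring.
  lra.
Qed.

Lemma Bayes_risk_chi2 (Iup : \bar R) :
  f_informativity (@f_chi2 R) w P <= Iup ->
  (2^-1)%:E * sup_radius w L ((4%:E * (1 + Iup))^-1) <= Bayes_risk w P L.
Proof.
move=> infI; apply: (Bayes_risk_ge mP L_ge0 mL (f_chi2_at0 R)) => s s0.
have I0 : 0 <= Iup.
  apply: le_trans infI; apply: (f_informativity_ge0 (alpha := 2%R) w mP).
    exact: f_chi2_at0.
  have := f_chi2_minorant (1 : R)%R.
  by rewrite mulr1 expr1n (_ : (1 + 1 = 2 :> R)%R)//; ring.
case: Iup I0 infI => [I| |]//; last first.
  by move=> _ _; rewrite addey// gt0_muley// invey lte_fin ltNge ltW.
rewrite lee_fin => I0 infI; rewrite -EFinD -EFinM inver ifF; last first.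
  by rewrite gt_eqF//; lra.
rewrite lte_fin -ltf_pV2 ?posrE ?invr_gt0; [|lra..].
rewrite invrK => sI.
have u0 : (0 < (2 * s)^-1 :> R)%R by rewrite invr_gt0; lra.
(* The tangents at [1 / (2 * s)] and at [0]; the latter is the constant [-1]. *)
exists (2 * (2 * s)^-1)%R, (2 * 0)%R, (- ((2 * s)^-1 ^+ 2 + 1))%R,
  (- (0 ^+ 2 + 1))%R.
split; [exact: f_chi2_minorant|exact: f_chi2_minorant| | |].
- by rewrite mulr0; lra.
- by have := sqr_ge0 (2 * s)^-1%R; rewrite expr0n/=; lra.
- apply: le_lt_trans infI _; rewrite lte_fin.
  rewrite [ltRHS](_ : _ = s^-1 / 4 - 1)%R; first lra.
  by field; rewrite gt_eqF.
Qed.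

Lemma Bayes_risk_TV (Iup : \bar R) :
  f_informativity (@f_TV R) w P <= Iup ->
  (2^-1)%:E * sup_radius w L ((2^-1)%:E - Iup) <= Bayes_risk w P L.
Proof.
move=> infI; apply: (Bayes_risk_ge mP L_ge0 mL (f_TV_at0 R)) => s s0 sI.
have half : (`|2^-1 : R| <= 2^-1)%R by rewrite ger0_norm.
have halfN : (`|- 2^-1 : R| <= 2^-1)%R by rewrite normrN.
(* The two extreme supporting lines, with slopes [1/2] and [-1/2]. *)
exists 2^-1%R, (- 2^-1)%R, (- 2^-1)%R, (- - 2^-1)%R.
split; [exact: f_TV_minorant|exact: f_TV_minorant|lra|lra|].
apply: le_lt_trans infI _.
rewrite [X in X%:E](_ : _ = 2^-1 - s)%R; last by field.
case: Iup sI => [I| |]//=; last by rewrite ltNyr.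
by rewrite -EFinB !lte_fin; lra.
Qed.

Lemma Bayes_risk_Hellinger (Iup : R) :
  f_informativity (@f_Hellinger R) w P <= Iup%:E ->
  (Iup < 1 - (Num.sqrt 2)^-1)%R ->
  (2^-1)%:E *
    sup_radius w L (2^-1 - (1 - Iup) * Num.sqrt (Iup * (2 - Iup)))%:E
  <= Bayes_risk w P L.
Proof.
move=> infI I1; apply: (Bayes_risk_ge mP L_ge0 mL (f_Hellinger_at0 R)) => s s0.
have I0 : (0 <= Iup)%R.
  rewrite -lee_fin; apply: le_trans infI.
  apply: (f_informativity_ge0 (alpha := (- (1 / 2))%R) w mP).
    exact: f_Hellinger_at0.
  have := f_Hellinger_minorant (@ltr01 R).
  by rewrite (_ : (1 - (2 * 1)^-1 = - - (1 / 2) :> R)%R)//; field.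
rewrite lte_fin => /(Hellinger_threshold I0 I1 s0)[s1].
set y := Num.sqrt (2 * s); set z := Num.sqrt (2 * (1 - s)) => Iyz.
have y0 : (0 < y)%R by rewrite sqrtr_gt0; lra.
have yz : (y <= z)%R by rewrite ler_sqrt; lra.
have z0 : (0 < z)%R by exact: lt_le_trans yz.
have sE : s = (y ^+ 2 / 2)%R by rewrite sqr_sqrtr; lra.
have s'E : (1 - s = z ^+ 2 / 2)%R by rewrite sqr_sqrtr; lra.
(* The tangents at [y^-2 = 1 / (2 * s)] and [z^-2 = 1 / (2 * (1 - s))]. *)
exists (- (y / 2))%R, (- (z / 2))%R, (1 - (2 * y)^-1)%R, (1 - (2 * z)^-1)%R.
split; [exact: f_Hellinger_minorant|exact: f_Hellinger_minorant|lra| |].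
- by rewrite lerD2l lerN2 lef_pV2 ?posrE; lra.
- apply: le_lt_trans infI _; rewrite lte_fin.
  have -> : ((1 - (2 * y)^-1) * s = s - y / 4)%R.
    by rewrite sE; field; rewrite gt_eqF.
  have -> : ((1 - (2 * z)^-1) * (1 - s) = (1 - s) - z / 4)%R.
    by rewrite s'E; field; rewrite gt_eqF.
  lra.
Qed.

End corollaries.

Theorem corollary4p4 (R : realType) (dT dX dA : measure_display)
    (Theta : measurableType dT) (X : measurableType dX)
    (A : measurableType dA)
    (w : probability Theta R) (P : Theta -> probability X R)
    (mP : forall U : set X, measurable U ->
      measurable_fun [set: Theta] (fun th => P th U))
    (L : Theta -> A -> R)
    (L_ge0 : forall th a, (0 <= L th a)%R)
    (mL : measurable_fun [set: Theta * A] (fun z : Theta * A => L z.1 z.2)) :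
  [/\ (* (i) Kullback-Leibler *)
      forall Iup : \bar R, f_informativity (@f_KL R) w P <= Iup ->
        (2^-1)%:E * sup_radius w L ((4^-1)%:E * expeR (- (2%:E * Iup)))
        <= Bayes_risk w P L,
      (* (ii) chi-squared *)
      forall Iup : \bar R, f_informativity (@f_chi2 R) w P <= Iup ->
        (2^-1)%:E * sup_radius w L ((4%:E * (1 + Iup))^-1)
        <= Bayes_risk w P L,
      (* (iii) total variation *)
      forall Iup : \bar R, f_informativity (@f_TV R) w P <= Iup ->
        (2^-1)%:E * sup_radius w L ((2^-1)%:E - Iup)
        <= Bayes_risk w P L &
      (* (iv) Hellinger *)
      forall Iup : R, f_informativity (@f_Hellinger R) w P <= Iup%:E ->
        (Iup < 1 - (Num.sqrt 2)^-1)%R ->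
        (2^-1)%:E *
          sup_radius w L
            (2^-1 - (1 - Iup) * Num.sqrt (Iup * (2 - Iup)))%:E
        <= Bayes_risk w P L].
Proof.
split.
- exact: Bayes_risk_KL.
- exact: Bayes_risk_chi2.
- exact: Bayes_risk_TV.
- exact: Bayes_risk_Hellinger.
Qed.
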